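(* Let $p$ be an odd prime and let $A=\mathrm{GF}(p)^n$. Let $\mathbf{x}_1,\mathbf{x}_2,\dots,\mathbf{x}_k\in A$ be nonzero vectors. The space $A$ is covered by the hyperplanes $\mathbf{x}_1^{\bot},\mathbf{x}_2^{\bot},\dots,\mathbf{x}_k^{\bot}$ (that is, their union is $A$) if and only if for every vector $\mathbf{v}\in A$ the number of $0$-$1$ combinations of the vectors $\mathbf{x}_1,\mathbf{x}_2,\dots,\mathbf{x}_k$ resulting in $\mathbf{v}$ is even.
   Context: $A$ is the space of row vectors of length $n$ with scalar product $(\mathbf{x},\mathbf{y})=\sum_{i=1}^n x_iy_i$, and $\mathbf{x}^{\bot}=\{\mathbf{y}\in A : (\mathbf{x},\mathbf{y})=0\}$. The number of $0$-$1$ combinations of $\mathbf{x}_1,\dots,\mathbf{x}_k$ resulting in $\mathbf{v}$ is the number of tuples $(\epsilon_1,\dots,\epsilon_k)\in\{0,1\}^k$ with $\sum_{i=1}^k\epsilon_i\mathbf{x}_i=\mathbf{v}$. *)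

(* Defs.v *)
From mathcomp Require Import all_boot all_order all_algebra.

Set Implicit Arguments.
Unset Strict Implicit.
Unset Printing Implicit Defensive.

Import GRing.Theory.
Local Open Scope ring_scope.

Definition dotv (F : finFieldType) (n : nat) (x y : 'rV[F]_n) : F :=
  \sum_(i < n) x 0 i * y 0 i.

Definition orthv (F : finFieldType) (n : nat) (x : 'rV[F]_n) : {set 'rV[F]_n} :=
  [set y | dotv x y == 0].

(* Counts coefficient tuples in {0,1}^k, encoded as boolean-valued functions
   on 'I_k with false = 0 and true = 1; repeated vectors among the x i are
   counted as separate summands. *)
Definition num_comb01 (F : finFieldType) (n k : nat) (x : 'I_k -> 'rV[F]_n)
    (v : 'rV[F]_n) : nat :=
  #|[set e : {ffun 'I_k -> bool} | \sum_(i < k) (e i)%:R *: x i == v]|.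

(* Main.v *)
(** Let [K] be a field of characteristic 2 containing a primitive [p]-th root
    of unity [z], and let [chi a = z ^ a].  The Fourier transform at [y] of the
    function counting 0-1 combinations is the product over [i] of
    [1 + chi (x_i, y)], which vanishes iff some factor does, i.e. (as [-1 = 1]
    in [K]) iff [y] is orthogonal to some [x_i].  So the hyperplanes cover the
    space iff the transform vanishes identically; as [p ^ n] is invertible in
    [K], Fourier inversion turns this into the vanishing of all counts in [K],
    i.e. modulo 2. *)
Require Import Defs.
From mathcomp Require Import all_boot all_order all_algebra.
From mathcomp Require Import fingroup cyclic pgroup finfield.

Set Implicit Arguments.
Unset Strict Implicit.
Unset Printing Implicit Defensive.

Import GRing.Theory.
Local Open Scope ring_scope.

Lemma dotvDr (F : finFieldType) n (u y y' : 'rV[F]_n) :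
  dotv u (y + y') = dotv u y + dotv u y'.
Proof. by rewrite -big_split /=; apply: eq_bigr => i _; rewrite mxE mulrDr. Qed.

Lemma dotvBl (F : finFieldType) n (u u' y : 'rV[F]_n) :
  dotv (u - u') y = dotv u y - dotv u' y.
Proof. by rewrite -sumrB; apply: eq_bigr => i _; rewrite !mxE mulrBl. Qed.

Lemma dotv_suml (F : finFieldType) n k (c : 'I_k -> F) (x : 'I_k -> 'rV[F]_n) y :
  dotv (\sum_i c i *: x i) y = \sum_i c i * dotv (x i) y.
Proof.
under [RHS]eq_bigr do rewrite mulr_sumr.
rewrite exchange_big; apply: eq_bigr => j _ /=.
by rewrite summxE mulr_suml; apply: eq_bigr => i _; rewrite mxE mulrA.
Qed.

Lemma dotv_delta (F : finFieldType) n (u : 'rV[F]_n) i :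
  dotv u (delta_mx 0 i) = u 0 i.
Proof.
rewrite /dotv (bigD1 i) //= big1 => [|j /negbTE ji]; rewrite !mxE ?eqxx.
  by rewrite mulr1 addr0.
by rewrite ji mulr0.
Qed.

Section Characters.

Variables (F : finFieldType) (K : fieldType) (chi : F -> K).
Hypothesis chi0 : chi 0 = 1.
Hypothesis chiD : {morph chi : a b / a + b >-> a * b}.
Hypothesis chi_eq1 : forall a, (chi a == 1) = (a == 0).

(** Translating [y] by the unit vector at a coordinate where [u] is nonzero multiplies the sum by
    [chi (u 0 i)], which differs from 1. *)
Lemma sum_char n (u : 'rV[F]_n) : u != 0 -> \sum_y chi (dotv u y) = 0.
Proof.
case/rV0Pn => i ui_neq0; set S := \sum_y _; pose y0 : 'rV[F]_n := delta_mx 0 i.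
have S_shift : S = chi (u 0 i) * S.
  rewrite {1}/S (reindex_inj (addrI y0)) mulr_sumr; apply: eq_bigr => y _ /=.
  by rewrite dotvDr chiD dotv_delta.
apply/eqP; move/eqP: S_shift; rewrite -subr_eq0 -{1}[S]mul1r -mulrBl mulf_eq0.
by rewrite subr_eq0 eq_sym chi_eq1 (negbTE ui_neq0).
Qed.

(** After exchanging the sums, [f v] is weighted by the sum of [chi (dotv (v - w) y)] over [y],
    which [sum_char] kills unless [v = w]. *)
Lemma fourier_inversion n (f : 'rV[F]_n -> K) w :
  \sum_y chi (- dotv w y) * (\sum_v f v * chi (dotv v y)) =
  #|{: 'rV[F]_n}|%:R * f w.
Proof.
under eq_bigr do rewrite mulr_sumr.
rewrite exchange_big (bigD1 w) //= [X in _ + X]big1 ?addr0 => [|v v_neq_w].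
  under eq_bigr do rewrite mulrCA -chiD addNr chi0 mulr1.
  by rewrite sumr_const mulr_natl.
under eq_bigr do rewrite mulrCA -chiD addrC -dotvBl.
by rewrite -mulr_sumr sum_char ?mulr0 // subr_eq0.
Qed.

(** Both sides equal the sum of [chi (dotv (comb e) y)] over all tuples [e]: grouping by the value
    of [comb e] gives the left side, distributing the product over the choices of each [e i] the
    right. *)
Lemma fourier_num_comb01 n k (x : 'I_k -> 'rV[F]_n) y :
  \sum_v (num_comb01 x v)%:R * chi (dotv v y) =
  \prod_i (1 + chi (dotv (x i) y)).
Proof.
pose comb (e : {ffun 'I_k -> bool}) := \sum_i (e i)%:R *: x i.
transitivity (\sum_e chi (dotv (comb e) y)).
  rewrite (partition_big comb predT) //=; apply: eq_bigr => v _.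
  under eq_bigr => e /eqP -> do [].
  rewrite sumr_const mulr_natl /num_comb01; congr (_ *+ _).
  by apply: eq_card => e; rewrite inE.
transitivity (\prod_i \sum_(b : bool) chi (b%:R * dotv (x i) y)).
  rewrite bigA_distr_bigA; apply: eq_bigr => e _ /=.
  by rewrite dotv_suml (big_morph chi chiD chi0).
by apply: eq_bigr => i _; rewrite big_bool mul1r mul0r chi0 addrC.
Qed.

Hypothesis pcharK2 : 2 \in [pchar K].

Lemma num_comb01_even_cover n k (x : 'I_k -> 'rV[F]_n) :
  #|F|%:R != 0 :> K ->
  \bigcup_(i < k) orthv (x i) = [set: 'rV[F]_n] <->
  (forall v, ~~ odd (num_comb01 x v)).
Proof.
move=> cardF_neq0.
have evenE v : ~~ odd (num_comb01 x v) = ((num_comb01 x v)%:R == 0 :> K).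
  by rewrite -(dvdn_pcharf pcharK2) dvdn2.
have coverE y : (y \in \bigcup_(i < k) orthv (x i)) =
    (\sum_v (num_comb01 x v)%:R * chi (dotv v y) == 0).
  rewrite fourier_num_comb01; apply/bigcupP/prodf_eq0 => -[i _] Hi; exists i => //.
    by move: Hi; rewrite inE => /eqP->; rewrite chi0 (addrr_pchar2 pcharK2).
  by move: Hi; rewrite inE -chi_eq1 addrC addr_eq0 (oppr_pchar2 pcharK2).
split=> [cover v | even_comb].
  have := fourier_inversion (fun w => (num_comb01 x w)%:R) v.
  rewrite big1 => [/esym/eqP | y _].
    rewrite evenE mulf_eq0 card_mx natrX expf_eq0 (negbTE cardF_neq0).
    by rewrite andbF.
  have: y \in \bigcup_(i < k) orthv (x i) by rewrite cover inE.
  by rewrite coverE => /eqP->; rewrite mulr0.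
apply/setP => y; rewrite coverE inE big1 ?eqxx // => v _.
by have := even_comb v; rewrite evenE => /eqP->; rewrite mul0r.
Qed.

End Characters.

(** The field with [2 ^ (p - 1)] elements works: by Fermat, [p] divides the order of its unit group,
    and Cauchy's theorem gives a unit of order [p]. *)
Lemma pchar2_prim_root p : prime p -> odd p ->
  exists (K : finFieldType) (z : K), 2 \in [pchar K] /\ p.-primitive_root z.
Proof.
move=> p_pr p_odd.
have p1_gt0 : (0 < p.-1)%N by rewrite -ltnS prednK ?prime_gt1 ?prime_gt0.
have [K pcharK cardK] := pPrimePowerField (isT : prime 2) p1_gt0.
exists K.
have p_dvd : (p %| #|[set: {unit K}]|)%N.
  rewrite card_finField_unit cardK -subn1 -eqn_mod_dvd ?expn_gt0 //.
  by rewrite -totient_prime // Euler_exp_totient // coprime2n.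
have [u _ ord_u] := Cauchy p_pr p_dvd.
exists (val u); split=> //.
apply/andP; split; first exact: prime_gt0.
(* Primitivity only tests exponents from 1 to [p], and the sole multiple of [p] among them is [p]
   itself. *)
apply/forallP => i; rewrite unity_rootE -FinRing.val_unitX -FinRing.val_unit1.
rewrite (inj_eq val_inj) -order_dvdn ord_u eqn_leq ltn_ord /=.
apply/eqP; apply/idP/idP => [/dvdn_leq-> // | p_le].
by have /eqP-> : i.+1 == p by rewrite eqn_leq ltn_ord.
Qed.

Theorem theorem7 (p n k : nat) (p_prime : prime p) (p_odd : odd p)
    (x : 'I_k -> 'rV['F_p]_n) (x_neq0 : forall i : 'I_k, x i != 0) :
  \bigcup_(i < k) orthv (x i) = [set: 'rV['F_p]_n] <->
  (forall v : 'rV['F_p]_n, ~~ odd (num_comb01 x v)).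
Proof.
have [K [z [pcharK2 z_prim]]] := pchar2_prim_root p_prime p_odd.
apply: (@num_comb01_even_cover _ K (fun a : 'F_p => z ^+ a)) => //.
(* The exponent is the representative below [p], so addition in ['F_p] reduces it modulo [p]; this
   is harmless since [z ^+ p = 1]. *)
- move=> a b; have -> : nat_of_ord (a + b) = ((a + b) %% p)%N.
    exact: (congr1 (modn (a + b)) (Fp_cast p_prime)).
  by rewrite (prim_expr_mod z_prim) exprD.
- move=> a; rewrite -(prim_order_dvd z_prim).
  have a_lt : (a < p)%N by rewrite -[X in (_ < X)%N](Fp_cast p_prime).
  by rewrite /dvdn modn_small.
- by rewrite card_Fp // -(dvdn_pcharf pcharK2) dvdn2 p_odd.
Qed.
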